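(* Let $\mathbb{M}$ be a weight sequence with sequence of quotients $\mathbf{m}=(m_p)_{p\in\mathbb{N}_0}$, and let $\beta\ge0$. The following are equivalent: (i) there exists $C>0$ such that $\sum_{k=p}^{\infty}\frac{(k+1)^{\beta-1}}{m_k}\le C\frac{(p+1)^{\beta}}{m_p}$ for all $p\in\mathbb{N}_0$; (ii) there exists $\varepsilon>0$ such that $(m_p/p^{\beta+\varepsilon})_{p\in\mathbb{N}}$ is almost increasing; (iii) there exists a sequence $\mathbf{h}\simeq\mathbf{m}$ such that $((p+1)^{-\beta}h_p)_{p\in\mathbb{N}_0}$ is nondecreasing and $\inf_{p\ge1}\frac{h_{2p}}{h_p}>2^{\beta}$; (iv) $\lim_{k\to\infty}\liminf_{p\to\infty}\frac{m_{kp}}{k^{\beta}m_p}=\infty$; (v) there exists $k\in\mathbb{N}$, $k\ge2$, such that $\liminf_{p\to\infty}\frac{m_{kp}}{m_p}>k^{\beta}$; (vi) for every $\theta\in(0,1)$ there exists $k\in\mathbb{N}$, $k\ge2$, such that $m_p\le\theta k^{-\beta}m_{kp}$ for every $p\in\mathbb{N}$; (vii) $\beta(\mathbf{m})>\beta$; (viii) $\gamma(\mathbb{M})>\beta$; (ix) there exists $C>0$ such that $\sum_{k=0}^{p}\frac{m_k}{(k+1)^{1+\beta}}\le C\frac{m_p}{(p+1)^{\beta}}$ for every $p\in\mathbb{N}_0$.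
   Context: A weight sequence is a sequence $\mathbb{M}=(M_p)_{p\in\mathbb{N}_0}$ of positive reals with $M_0=1$, logarithmically convex ($M_p^2\le M_{p-1}M_{p+1}$ for $p\in\mathbb{N}$) and $\lim_{p\to\infty}M_p^{1/p}=\infty$; its quotients are $m_p=M_{p+1}/M_p$. A sequence $(a_p)_{p\in\mathbb{N}}$ is almost increasing if there is $M>0$ with $a_p\le Ma_q$ for all $p\le q$. $\mathbf{h}\simeq\mathbf{m}$ means there is $c\ge1$ with $c^{-1}m_p\le h_p\le cm_p$ for all $p$. $\beta(\mathbf{m})$ is the lower Matuszewska index of the sequence $(m_{p-1})_{p\in\mathbb{N}}$, defined as $\beta(f)$ for the step function $f(x)=m_{\lfloor x\rfloor-1}$, $x\ge1$, where $\beta(f):=\sup\{\beta\in\mathbb{R}:\exists D_\beta>0\ \forall\Lambda>1,\ \liminf_{x\to\infty}\inf_{\lambda\in[1,\Lambda]}\frac{f(\lambda x)}{\lambda^{\beta}f(x)}\ge D_\beta\}$. For $\gamma\in\mathbb{R}$, $\mathbb{M}$ satisfies $(P_\gamma)$ if there is a real sequence $\boldsymbol{\ell}\simeq\mathbf{m}$ with $((p+1)^{-\gamma}\ell_p)_{p\in\mathbb{N}_0}$ nondecreasing; $\gamma(\mathbb{M}):=\sup\{\gamma\in\mathbb{R}:(P_\gamma)\text{ holds}\}$ ($\sup\emptyset=-\infty$). *)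

(* Defs.v *)
From mathcomp Require Import all_boot all_order all_algebra.
From mathcomp Require Import all_classical all_reals all_analysis.
Set Implicit Arguments. Unset Strict Implicit. Unset Printing Implicit Defensive.
Import Order.TTheory GRing.Theory Num.Theory.
Import numFieldNormedType.Exports.
Local Open Scope classical_set_scope.
Local Open Scope ring_scope.

Section Defs.
Variable R : realType.

Definition weight_sequence (M : nat -> R) : Prop :=
  [/\ M 0%N = 1,
      (forall p, 0 < M p),
      (forall p, (0 < p)%N -> M p ^+ 2 <= M p.-1 * M p.+1) &
      (fun p : nat => M p `^ (p%:R)^-1) @ \oo --> +oo].

Definition quot (M : nat -> R) (p : nat) : R := M p.+1 / M p.

Definition almost_increasing (a : nat -> R) : Prop :=
  exists K : R, 0 < K /\ forall p q : nat, (1 <= p)%N -> (p <= q)%N -> a p <= K * a q.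

Definition equiv_seq (h m : nat -> R) : Prop :=
  exists c : R, 1 <= c /\ forall p, c^-1 * m p <= h p /\ h p <= c * m p.

Definition liminf_infty (g : R -> \bar R) : \bar R :=
  ereal_sup [set ereal_inf [set g y | y in [set y | x <= y]] | x in [set: R]].

Definition step_fun (m : nat -> R) (x : R) : R := m (Num.truncn x).-1.

Definition matuszewska_lower (f : R -> R) : \bar R :=
  ereal_sup [set b%:E | b in
    [set b : R | exists D : R, 0 < D /\ forall L : R, 1 < L ->
       (D%:E <= liminf_infty (fun x =>
          ereal_inf [set (f (l * x) / (l `^ b * f x))%:E | l in [set l : R | (1 <= l <= L)%R]]))%E]].

(* beta(m) for the sequence (m_{p-1})_{p>=1} *)
Definition beta_index (m : nat -> R) : \bar R := matuszewska_lower (step_fun m).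

Definition P_gamma (M : nat -> R) (g : R) : Prop :=
  exists l : nat -> R, equiv_seq l (quot M) /\
    nondecreasing_seq (fun p : nat => (p.+1%:R) `^ (- g) * l p).

Definition gamma_index (M : nat -> R) : \bar R :=
  ereal_sup [set g%:E | g in [set g : R | P_gamma M g]].

End Defs.

(* Main.v *)
(* Everything is compared with two growth properties of the positive nondecreasing sequence m:
   power growth, m_p / p^a almost increasing for some a > beta, and dilation growth, m_(kp) >= y m_p
   for large p with some k >= 2 and y > k^beta. Iterating the dilation inequality along p, kp, k^2 p, ...
   yields power growth with a = log_k y, since m is nondecreasing. Each of the nine conditions follows
   from power growth and implies one of the two properties; the summation conditions do so because their
   tails (resp. partial sums) contract (resp. expand) by a fixed factor from p to 2p. *)
Require Import Defs.
From mathcomp Require Import all_boot all_order all_algebra.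
From mathcomp Require Import all_classical all_reals all_analysis.
From mathcomp Require Import zify ring lra.
Import Order.TTheory GRing.Theory Num.Theory.
Import numFieldNormedType.Exports.
Local Open Scope classical_set_scope.
Local Open Scope ring_scope.


(** * Extended reals and lower limits *)

(** Keeps a strict gap usable when [z] may be infinite: the real [y] later serves as a dilation
    factor. *)
Lemma lte_fin_witness (R : realType) (x : R) (z : \bar R) :
  (x%:E < z)%E -> exists2 y, x < y & (y%:E <= z)%E.
Proof.
case: z => [r|_|//]; first by rewrite lte_fin => xr; exists r.
by exists (x + 1); rewrite ?ltrDl// leey.
Qed.

Lemma limn_einf_sup_einfs (R : realType) (u : nat -> \bar R) :
  limn_einf u = ereal_sup (range (einfs u)).
Proof. by rewrite limn_einf_lim; apply/cvg_lim => //; exact: cvg_einfs_sup. Qed.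

(** The lower limit is the supremum of the tail infima, so a single tail infimum already exceeds
    [x]. *)
Lemma limn_einf_gt (R : realType) (u : nat -> R) (x : R) :
  (x%:E < limn_einf (fun n => (u n)%:E))%E ->
  exists y N, x < y /\ forall n, (N <= n)%N -> y <= u n.
Proof.
rewrite limn_einf_sup_einfs.
move=> /ereal_sup_gt[_ [N _ <-]] xN.
have [y xy yN] := lte_fin_witness _ _ _ xN.
exists y, N; split=> //.
move=> n Nn; rewrite -lee_fin (le_trans yN)//.
by apply: ereal_inf_lbound; exists n.
Qed.

Lemma limn_einf_ge (R : realType) (u : nat -> R) (y : R) N :
  (forall n, (N <= n)%N -> y <= u n) ->
  (y%:E <= limn_einf (fun n => (u n)%:E))%E.
Proof.
move=> yu; rewrite limn_einf_sup_einfs.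
apply: (@le_trans _ _ (einfs (fun n => (u n)%:E) N)); last first.
  by apply: ereal_sup_ubound; exists N.
by apply: le_ereal_inf_tmp => _ [n /= Nn <-]; rewrite lee_fin yu.
Qed.

(** * Real powers of natural numbers: unboundedness and telescoping estimates *)

Lemma expr_unbounded (R : realType) (x y : R) : 1 < x -> exists n, y < x ^+ n.
Proof.
move=> x1; exists (Num.bound `|y / (x - 1)|).
set n := Num.bound _.
have x10 : 0 < x - 1 by rewrite subr_gt0.
have bern k : 1 + k%:R * (x - 1) <= x ^+ k.
  elim: k => [|k ih]; first by rewrite mul0r addr0 expr0.
  rewrite exprS (le_trans _ (ler_wpM2l _ ih))//; last lra.
  have : 0 <= k%:R * (x - 1) ^+ 2 by rewrite mulr_ge0// sqr_ge0.
  by rewrite -natr1; lra.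
apply: lt_le_trans (bern n).
have : y / (x - 1) < n%:R by rewrite (le_lt_trans (ler_norm _))// archi_boundP.
by rewrite ltr_pdivrMr//; lra.
Qed.

Lemma ler_natpowR (R : realType) (a : R) p q : 0 <= a -> (p <= q)%N ->
  (p%:R : R) `^ a <= q%:R `^ a.
Proof. by move=> a0 pq; rewrite ge0_ler_powR ?nnegrE ?ler_nat. Qed.

Lemma powR_unbounded (R : realType) (e y : R) : 0 < e ->
  exists N, forall k, (N <= k)%N -> y <= (k%:R : R) `^ e.
Proof.
move=> e0; set z := Num.max y 1.
have z0 : 0 < z by rewrite lt_max ltr01 orbT.
exists (Num.bound (z `^ e^-1)) => k Nk.
apply: (@le_trans _ _ z); first by rewrite le_max lexx.
have -> : z = (z `^ e^-1) `^ e.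
  by rewrite -powRrM mulVf ?gt_eqF// powRr1// ltW.
rewrite ge0_ler_powR ?nnegrE ?powR_ge0// ?ltW//.
apply: lt_le_trans (archi_boundP (powR_ge0 _ _)) _.
by rewrite ler_nat.
Qed.

(* Tangent inequality [x `^ e >= 1 + e * ln x] at [x = (n + 1) / n], with [ln x >= 1 / (n + 1)]. *)
Lemma powR_incr_ge (R : realType) (e : R) n : 0 < e -> (0 < n)%N ->
  e * n%:R `^ e / n.+1%:R <= n.+1%:R `^ e - (n%:R : R) `^ e.
Proof.
move=> e0 n0; have n0' : 0 < n%:R :> R by rewrite ltr0n.
have n1' : 0 < n.+1%:R :> R by rewrite ltr0n.
set x := n.+1%:R / n%:R : R.
have x0 : 0 < x by rewrite divr_gt0.
have lnx : 1 / n.+1%:R <= ln x.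
  rewrite -[x]invrK lnV ?posrE ?invr_gt0//.
  have := @le_ln1Dx R (x^-1 - 1); rewrite ltrBrDr addNr invr_gt0 => /(_ x0).
  have -> : 1 + (x^-1 - 1) = x^-1 by ring.
  move=> h.
  have : x^-1 - 1 = - (1 / n.+1%:R).
    rewrite /x invf_div -natr1; field.
    by rewrite natr1 gt_eqF.
  by move=> xe; rewrite lerNr -xe.
have xe : 1 + e * ln x <= x `^ e.
  by rewrite /powR gt_eqF// expR_ge1Dx.
have -> : n.+1%:R `^ e = n%:R `^ e * x `^ e.
  by rewrite -powRM ?(ltW x0)// /x mulrCA divff ?mulr1 ?gt_eqF.
rewrite [e * _]mulrC -mulrA -[X in _ - X]mulr1 -mulrBr ler_wpM2l ?powR_ge0//.
have : e * (1 / n.+1%:R) <= e * ln x by rewrite ler_pM2l.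
by rewrite mul1r => elnx; rewrite lerBrDl (le_trans _ xe)// lerD2l.
Qed.

Lemma natpowR_gt0 (R : realType) (a : R) n : (0 < n)%N -> 0 < (n%:R : R) `^ a.
Proof. by move=> n0; rewrite powR_gt0// ltr0n. Qed.

Lemma pow1R (R : realType) (a : R) : 1 `^ a = 1 :> R.
Proof. by rewrite powR1. Qed.

Lemma natpowR_ge1 (R : realType) (a : R) p : 0 <= a -> (0 < p)%N ->
  1 <= (p%:R : R) `^ a.
Proof.
by move=> a0 p0; rewrite -[leLHS](@pow1R R a) ge0_ler_powR ?nnegrE// ler1n.
Qed.

Lemma natpowRM (R : realType) (a : R) p q :
  ((p * q)%N%:R : R) `^ a = p%:R `^ a * q%:R `^ a.
Proof. by rewrite natrM powRM. Qed.

Lemma natpowRX (R : realType) (a : R) k n :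
  ((k ^ n)%N%:R : R) `^ a = (k%:R `^ a) ^+ n.
Proof.
elim: n => [|n ih]; first by rewrite expn0 expr0 powR1.
by rewrite expnS natpowRM ih exprS.
Qed.

(** Sums of [n^(e-1)] become telescoping sums of [n^e]; the factor 2 absorbs [(n+1)/n]. *)
Lemma powR_telescope_incr (R : realType) (e : R) n : 0 < e -> (0 < n)%N ->
  (n%:R : R) `^ e / n%:R <= 2 / e * (n.+1%:R `^ e - n%:R `^ e).
Proof.
move=> e0 n0; have n0' : 0 < n%:R :> R by rewrite ltr0n.
apply: (@le_trans _ _ (2 / e * (e * n%:R `^ e / n.+1%:R))); last first.
  by rewrite ler_wpM2l ?divr_ge0 ?(ltW e0)// powR_incr_ge.
rewrite [leRHS](_ : _ = n%:R `^ e * (2 / n.+1%:R)); last first.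
  by field; rewrite !gt_eqF// ltr0n.
rewrite ler_wpM2l ?powR_ge0// ler_pdivlMr// mulrC ler_pdivrMr// -natrM ler_nat.
by lia.
Qed.

(** Sums of [n^(-1-e)] become telescoping sums of [n^(-e)]. The difference of reciprocals is the
    increment of [n^e] divided by [n^e (n+1)^e]; the factors 2 and [2^e] come from [n+1 <= 2n]. *)
Lemma powR_telescope_decr (R : realType) (e : R) n : 0 < e -> (0 < n)%N ->
  (n%:R * (n%:R : R) `^ e)^-1 <=
  2 * 2%:R `^ e / e * ((n%:R `^ e)^-1 - (n.+1%:R `^ e)^-1).
Proof.
move=> e0 n0; have n0' : 0 < n%:R :> R by rewrite ltr0n.
have := @powR_incr_ge R e n e0 n0.
have : (n.+1%:R : R) `^ e <= 2%:R `^ e * n%:R `^ e.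
  by rewrite -natpowRM ler_natpowR ?(ltW e0)//; lia.
have x0 : 0 < (n%:R : R) `^ e by rewrite natpowR_gt0.
have y0 : 0 < (n.+1%:R : R) `^ e by rewrite natpowR_gt0.
have z0 : 0 < (2%:R : R) `^ e by rewrite natpowR_gt0.
have n2 : (n.+1%:R : R) <= 2 * n%:R by rewrite -natrM ler_nat; lia.
move: (n%:R `^ e) (n.+1%:R `^ e) (2%:R `^ e) x0 y0 z0 => x y z x0 y0 z0 yx h.
rewrite [leRHS](_ : _ = 2 * z / e / (x * y) * (y - x)); last first.
  by field; rewrite !gt_eqF.
apply: le_trans (ler_wpM2l _ h); last by rewrite !divr_ge0 ?mulr_ge0 ?ltW.
rewrite [leRHS](_ : _ = (2 * z) / (n.+1%:R * y)); last first.
  by field; rewrite !gt_eqF// ltr0n.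
rewrite ler_pdivlMr ?mulr_gt0// mulrC ler_pdivrMr ?mulr_gt0//.
rewrite [leRHS](_ : _ = 2 * n%:R * (z * x)); last by ring.
by rewrite ler_pM// ltW.
Qed.

(** * The two growth properties and how each yields the other's inequalities *)

Section Growth.
Variables (R : realType) (m : nat -> R) (beta : R).
Hypotheses (m_gt0 : forall p, 0 < m p) (m_nd : nondecreasing_seq m).
Hypothesis beta_ge0 : 0 <= beta.

Let m_ge0 p : 0 <= m p. Proof. exact: ltW. Qed.

(** The inequality is asked only from some [N] on, as lower limits give no more; the strict gap
    between [y] and [k^beta] is what produces an exponent above [beta]. *)
Definition dilation_growth := exists (k : nat) (y : R) (N : nat),
  [/\ (2 <= k)%N, k%:R `^ beta < y & forall p, (N <= p)%N -> y * m p <= m (k * p)%N].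

(** Almost monotonicity of [m p / p^a], cross-multiplied to avoid quotients. *)
Definition power_growth := exists a K : R,
  [/\ beta < a, 0 < K & forall p q, (1 <= p)%N -> (p <= q)%N ->
    m p * q%:R `^ a <= K * (m q * p%:R `^ a)].

Lemma dilation_growth_power : dilation_growth -> power_growth.
Proof.
move=> [k [y [N [k2 ky ym]]]].
have k1 : 1 < k%:R :> R by rewrite ltr1n.
have k0 : 0 < k%:R :> R by rewrite (lt_trans _ k1).
have y0 : 0 < y by rewrite (le_lt_trans _ ky)// powR_ge0.
have lnk : 0 < ln k%:R :> R by rewrite ln_gt0.
pose a := ln y / ln (k%:R : R).
have ka : k%:R `^ a = y.
  by rewrite /powR gt_eqF// /a divfK ?gt_eqF// lnK.
have ba : beta < a.
  by rewrite /a ltr_pdivlMr// -ln_powR ltr_ln// posrE powR_gt0.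
have a0 : 0 <= a by rewrite (le_trans beta_ge0) ?ltW.
have iter n p : (N <= p)%N -> y ^+ n * m p <= m (k ^ n * p)%N.
  move=> Np; elim: n => [|n ih]; first by rewrite expr0 mul1r expn0 mul1n.
  rewrite exprS -mulrA (le_trans (ler_wpM2l (ltW y0) ih))//.
  rewrite expnS -mulnA ym// (leq_trans Np)// leq_pmull// expn_gt0.
  by rewrite (leq_trans _ k2).
(* The successor makes every [p >= N1] positive, so that [q %/ p] below is a genuine quotient. *)
pose N1 := N.+1.
have N1a : 0 < N1%:R `^ a by rewrite natpowR_gt0.
have large p q : (N1 <= p)%N -> (p <= q)%N ->
    m p * q%:R `^ a <= y * (m q * p%:R `^ a).
  move=> Np pq; have p0 : (0 < p)%N by apply: leq_trans Np.
  (* Choose [n] with [k^n p <= q < k^(n+1) p]: iteration reaches [k^n p], and the last incomplete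
     step costs one factor [k^a = y]. *)
  have /trunc_log_bounds := k2 => /(_ (q %/ p)%N); rewrite divn_gt0// => /(_ pq).
  set n := trunc_log _ _ => /andP[]; rewrite leq_divRL// ltn_divLR// => kn kn1.
  apply: (@le_trans _ _ (m p * (k ^ n.+1 * p)%N%:R `^ a)).
    by rewrite ler_wpM2l// ler_natpowR// ltnW.
  rewrite natpowRM natpowRX ka exprS [leLHS](_ : _ = y * p%:R `^ a * (y ^+ n * m p)); last by ring.
  rewrite [leRHS](_ : _ = y * p%:R `^ a * m q); last by ring.
  rewrite ler_wpM2l ?mulr_ge0 ?powR_ge0 ?(ltW y0)//.
  rewrite (le_trans (iter _ _ _)) ?(ltnW Np)//; exact: m_nd.
have y1 : 1 <= y.
  by rewrite -ka -[leLHS](@pow1R R a) ge0_ler_powR ?nnegrE// ltW.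
(* The extra factor [N1^a] covers [p < N1]: either [q < N1] as well, or the estimate is started at
   [N1] using [m p <= m N1]. *)
exists a, (y * N1%:R `^ a); split=> //; first exact: mulr_gt0.
move=> p q p1 pq.
have pa1 : 1 <= p%:R `^ a by rewrite natpowR_ge1.
have [qN|Nq] := leqP N1 q; last first.
  apply: (@le_trans _ _ (m q * N1%:R `^ a)).
    by rewrite ler_pM ?powR_ge0 ?m_nd// ler_natpowR// ltnW.
  rewrite [leRHS](_ : _ = (m q * N1%:R `^ a) * (y * p%:R `^ a)); last by ring.
  by rewrite ler_peMr ?mulr_ge0 ?powR_ge0// mulr_ege1.
have [pN|Np] := leqP N1 p.
  rewrite (le_trans (large _ _ pN pq))// mulrAC -mulrA ler_wpM2l ?(ltW y0)//.
  by rewrite ler_peMr ?mulr_ge0 ?powR_ge0// natpowR_ge1.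
apply: (@le_trans _ _ (m N1 * q%:R `^ a)).
  by rewrite ler_wpM2r ?powR_ge0// m_nd// ltnW.
rewrite (le_trans (large _ _ (leqnn _) qN))//.
rewrite [leRHS](_ : _ = y * (m q * N1%:R `^ a) * p%:R `^ a); last by ring.
by rewrite ler_peMr ?mulr_ge0 ?powR_ge0 ?(ltW y0).
Qed.

(** Constants lost in an estimate are harmless when the gain over [k^beta] is geometric in [j]: take
    [j] with [c s^j > 1]. *)
Lemma dilation_growth_geometric (c s : R) : 0 < c -> 1 < s ->
  (forall j, exists2 k, (2 <= k)%N & forall p, (1 <= p)%N ->
    c * s ^+ j * k%:R `^ beta * m p <= m (k * p)%N) ->
  dilation_growth.
Proof.
move=> c0 s1 geo; have [j cj] := @expr_unbounded R s c^-1 s1.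
have [k k2 km] := geo j.
exists k, (c * s ^+ j * k%:R `^ beta), 1%N; split=> //.
rewrite ltr_pMl ?natpowR_gt0 ?(leq_trans _ k2)//.
by rewrite mulrC -ltr_pdivrMr// div1r.
Qed.

(** Take [q = k p] and split [k^a = k^(a-beta) k^beta]; the first factor is a surplus that grows
    with [k]. *)
Lemma power_growth_dilate : power_growth ->
  exists c e : R, [/\ 0 < c, 0 < e & forall k p, (1 <= k)%N -> (1 <= p)%N ->
    c * k%:R `^ e * (k%:R `^ beta * m p) <= m (k * p)%N].
Proof.
move=> [a [K [ba K0 mK]]]; exists K^-1, (a - beta).
split; rewrite ?invr_gt0 ?subr_gt0// => k p k1 p1.
have := mK p (k * p)%N p1 (leq_pmull _ k1).
rewrite natpowRM [leLHS](_ : _ = (k%:R `^ a * m p) * p%:R `^ a); last by ring.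
rewrite [X in _ <= X]mulrA ler_pM2r ?natpowR_gt0// => kpm.
rewrite -mulrA ler_pdivrMl// (le_trans _ kpm)// mulrA -powRD ?subrK//.
by apply/implyP => _; rewrite pnatr_eq0 -lt0n.
Qed.

(** * From the summation conditions to dilation growth *)

(* With [T Q = sum_(Q - 1 <= k < N) t k], the hypothesis bounds [t k] below by [T (k + 1) / (C (k + 1))];
   summing over [P - 1 <= k < 2 P - 1] gives [(1 + 1 / (2 C)) T (2 P) <= T P], so [T] decays
   geometrically along dyadic scales. *)
Lemma tail_sum_dilation (C : R) : 0 < C ->
  (forall p N, \sum_(p <= k < N) k.+1%:R `^ (beta - 1) / m k <=
     C * (p.+1%:R `^ beta / m p)) ->
  dilation_growth.
Proof.
move=> C0 sumC.
pose t k := k.+1%:R `^ (beta - 1) / m k.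
have tE k : t k = k.+1%:R `^ beta / m k / k.+1%:R.
  rewrite /t powRD; last by rewrite pnatr_eq0 implybT.
  by rewrite powR_inv1// mulrAC.
have t0 k : 0 <= t k by rewrite divr_ge0 ?powR_ge0.
pose T N P := \sum_(P.-1 <= k < N) t k.
have T0 N P : 0 <= T N P by rewrite sumr_ge0.
have Tle N P Q : (P <= Q)%N -> T N Q <= T N P.
  move=> PQ; have PQ1 : (P.-1 <= Q.-1)%N by rewrite -!subn1 leq_sub2r.
  rewrite /T; have [QN|NQ] := leqP Q.-1 N; last first.
    by rewrite [leLHS]big_geq ?sumr_ge0// ltnW.
  by rewrite (big_cat_nat PQ1 QN)//= lerDr sumr_ge0.
have Tt N k : T N k.+1 <= C * (t k * k.+1%:R).
  by rewrite tE divfK ?pnatr_eq0//; exact: sumC.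
pose rho := 1 + (2 * C)^-1.
have rho1 : 1 < rho by rewrite ltrDl invr_gt0 mulr_gt0.
have double N P : (0 < P)%N -> rho * T N (2 * P)%N <= T N P.
  move=> P0; have [N2|N2] := leqP (2 * P).-1 N; last first.
    by rewrite [T N (2 * P)%N]/T big_geq ?mulr0// ltnW.
  have PP : (P.-1 <= (2 * P).-1)%N by rewrite -!subn1 leq_sub2r// leq_pmull.
  rewrite [leRHS]/T (big_cat_nat PP N2)//= -/(T N (2 * P)%N).
  rewrite /rho mulrDl mul1r addrC lerD2l.
  have : \sum_(P.-1 <= k < (2 * P).-1) T N (2 * P)%N / (C * (2 * P)%N%:R) <=
      \sum_(P.-1 <= k < (2 * P).-1) t k.
    apply: ler_sum_nat => k /andP[_ k2].
    have k2' : (k.+1 <= 2 * P)%N by move: k2; rewrite ltn_predRL => /ltnW.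
    rewrite ler_pdivrMr ?mulr_gt0 ?ltr0n ?muln_gt0//.
    rewrite (le_trans (Tle _ _ _ k2'))// (le_trans (Tt _ _))// mulrCA.
    by rewrite ler_wpM2l// ler_wpM2l ?(ltW C0)// ler_nat.
  rewrite sumr_const_nat (_ : _ - _ = P)%N; last first.
    by case: P P0 {PP N2} => // P _; rewrite mul2n -addnn addSn /= addKn.
  apply: le_trans; rewrite -[leRHS]mulr_natl natrM [leRHS](_ : _ = (2 * C)^-1 * T N (2 * P)%N)//.
  by field; rewrite pnatr_eq0 -lt0n P0 gt_eqF.
have iter N j P : (0 < P)%N -> rho ^+ j * T N (2 ^ j * P)%N <= T N P.
  move=> P0; elim: j => [|j ih]; first by rewrite expr0 mul1r mul1n.
  apply: le_trans ih; rewrite exprSr -mulrA ler_wpM2l ?exprn_ge0 ?(ltW (lt_trans _ rho1))//.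
  by rewrite expnS -mulnA double// muln_gt0 expn_gt0.
(* The block [Q <= k < 2Q] has [Q] terms, each at least [Q^beta / (2Q m (2Q))]. *)
have below Q : (0 < Q)%N -> Q%:R `^ beta / (2 * m (2 * Q)%N) <= T (2 * Q)%N Q.
  move=> Q0; have QQ : (Q <= 2 * Q)%N by rewrite leq_pmull.
  have Q1 : (Q.-1 <= Q)%N by rewrite leq_pred.
  rewrite /T (big_cat_nat Q1 QQ)//= (@le_trans _ _ (\sum_(Q <= k < 2 * Q) t k))//; last first.
    by rewrite lerDr sumr_ge0.
  apply: le_trans (_ : \sum_(Q <= k < 2 * Q) Q%:R `^ beta / m (2 * Q)%N / (2 * Q)%:R <= _).
    rewrite sumr_const_nat mul2n -addnn addnK addnn -mul2n natrM -[leRHS]mulr_natl.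
    rewrite [leRHS](_ : _ = Q%:R `^ beta / (2 * m (2 * Q)%N))//.
    by field; rewrite gt_eqF// pnatr_eq0 -lt0n Q0.
  apply: ler_sum_nat => k /andP[Qk k2]; rewrite tE.
  rewrite ler_pM ?divr_ge0 ?powR_ge0 ?invr_ge0//; last first.
    by rewrite lef_pV2 ?posrE ?ltr0n ?muln_gt0// ler_nat.
  rewrite ler_pM ?powR_ge0 ?invr_ge0//; first exact/ler_natpowR/leqW.
  by rewrite lef_pV2 ?posrE// m_nd// ltnW.
have four0 : 0 < 4%:R `^ beta :> R by rewrite natpowR_gt0.
apply: (@dilation_growth_geometric (2 * C * 4%:R `^ beta)^-1 rho) => //.
  by rewrite invr_gt0 !mulr_gt0.
(* With [Q = 2^j (p+1)], the factor 4 ensures [2Q <= 2^j 4 p] for [p >= 1]; the matching [4^beta] is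
   cancelled by the constant chosen above. *)
move=> j; exists (2 ^ j * 4)%N; first by rewrite (@leq_trans (1 * 4))// leq_mul2r expn_gt0.
move=> p p1; have j0 : (0 < 2 ^ j)%N by rewrite expn_gt0.
pose Q := (2 ^ j * p.+1)%N.
have Q0 : (0 < Q)%N by rewrite muln_gt0 j0.
have m2Q : m (2 * Q)%N <= m (2 ^ j * 4 * p)%N.
  by apply: m_nd; rewrite /Q mulnCA -mulnA leq_mul2l; apply/orP; right; lia.
apply: le_trans m2Q.
have rj : 0 < rho ^+ j by rewrite exprn_gt0// (lt_trans _ rho1).
have h1 := le_trans (ler_wpM2l (ltW rj) (below _ Q0)) (iter _ _ _ (ltn0Sn p)).
have {h1} := le_trans h1 (sumC p (2 * Q)%N).
rewrite {1}/Q !natpowRM => h.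
have pb : 0 < p.+1%:R `^ beta :> R by rewrite natpowR_gt0.
move: h; rewrite [leLHS](_ : _ = (rho ^+ j * (2 ^ j)%:R `^ beta / (2 * m (2 * Q)%N)) * p.+1%:R `^ beta); last by ring.
rewrite mulrCA mulrC ler_pM2l// ler_pdivrMr ?mulr_gt0//.
rewrite mulrAC ler_pdivlMr// => h.
rewrite [leLHS](_ : _ = (rho ^+ j * (2 ^ j)%:R `^ beta * m p) / (2 * C)); last first.
  by field; rewrite !gt_eqF.
by rewrite ler_pdivrMr ?mulr_gt0// (le_trans h)// mulrCA mulrA [m _ * _]mulrC.
Qed.

(* Dual to [tail_sum_dilation]: here the partial sums [V] grow geometrically along dyadic scales. *)
Lemma head_sum_dilation (C : R) : 0 < C ->
  (forall p, \sum_(0 <= k < p.+1) m k / k.+1%:R `^ (1 + beta) <=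
     C * (m p / p.+1%:R `^ beta)) ->
  dilation_growth.
Proof.
move=> C0 sumC.
pose t k := m k / k.+1%:R `^ (1 + beta).
have tE k : t k = m k / k.+1%:R `^ beta / k.+1%:R.
  rewrite /t powRD; last by rewrite pnatr_eq0 implybT.
  by rewrite powRr1// invfM mulrA mulrAC.
have t0 k : 0 <= t k by rewrite divr_ge0 ?powR_ge0.
pose V P := \sum_(0 <= k < P) t k.
have V0 P : 0 <= V P by rewrite sumr_ge0.
have VS P Q : (P <= Q)%N -> V Q = V P + \sum_(P <= k < Q) t k.
  by move=> PQ; rewrite /V (big_cat_nat (leq0n P) PQ).
have Vt k : V k.+1 <= C * (t k * k.+1%:R).
  by rewrite tE divfK ?pnatr_eq0//; exact: sumC.
pose s := 1 + (2 * C)^-1.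
have s1 : 1 < s by rewrite ltrDl invr_gt0 mulr_gt0.
have double P : (0 < P)%N -> s * V P <= V (2 * P)%N.
  move=> P0; have PP : (P <= 2 * P)%N by rewrite leq_pmull.
  rewrite (VS _ _ PP) /s mulrDl mul1r lerD2l.
  have : \sum_(P <= k < 2 * P) V P / (C * (2 * P)%N%:R) <= \sum_(P <= k < 2 * P) t k.
    apply: ler_sum_nat => k /andP[Pk k2].
    rewrite ler_pdivrMr ?mulr_gt0 ?ltr0n ?muln_gt0//.
    apply: (@le_trans _ _ (V k.+1)).
      by rewrite (VS P k.+1) ?lerDl ?sumr_ge0// ltnW.
    rewrite (le_trans (Vt _))// mulrCA.
    by rewrite ler_wpM2l// ler_wpM2l ?(ltW C0)// ler_nat.
  rewrite sumr_const_nat mul2n -addnn addnK addnn -mul2n.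
  apply: le_trans; rewrite -[leRHS]mulr_natl natrM [leRHS](_ : _ = (2 * C)^-1 * V P)//.
  by field; rewrite pnatr_eq0 -lt0n P0 gt_eqF.
have iter j P : (0 < P)%N -> s ^+ j * V P <= V (2 ^ j * P)%N.
  move=> P0; elim: j => [|j ih]; first by rewrite expr0 mul1r mul1n.
  rewrite exprS -mulrA (le_trans (ler_wpM2l (ltW (lt_trans _ s1)) ih))//.
  by rewrite expnS -mulnA double// muln_gt0 expn_gt0.
pose b2 := 2%:R `^ beta : R.
have b20 : 0 < b2 by rewrite natpowR_gt0.
(* The block [P <= k < 2P] has [P] terms, each at least [m P / (2P)^(1+beta)]. *)
have below P : (0 < P)%N -> m P / (2 * b2 * P%:R `^ beta) <= V (2 * P)%N.
  move=> P0; have PP : (P <= 2 * P)%N by rewrite leq_pmull.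
  rewrite (VS _ _ PP) (@le_trans _ _ (\sum_(P <= k < 2 * P) t k))//; last first.
    by rewrite lerDr.
  apply: le_trans (_ : \sum_(P <= k < 2 * P) m P / (2 * P)%:R `^ beta / (2 * P)%:R <= _).
    rewrite sumr_const_nat mul2n -addnn addnK addnn -mul2n natpowRM -/b2 natrM -[leRHS]mulr_natl.
    rewrite [leRHS](_ : _ = m P / (2 * b2 * P%:R `^ beta))//.
    by field; rewrite !gt_eqF// ?natpowR_gt0// ?ltr0n.
  apply: ler_sum_nat => k /andP[Pk k2]; rewrite tE.
  have k20 : 0 < k.+1%:R `^ beta :> R by rewrite natpowR_gt0.
  rewrite ler_pM ?divr_ge0 ?powR_ge0 ?invr_ge0//; last first.
    by rewrite lef_pV2 ?posrE ?ltr0n ?muln_gt0// ler_nat.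
  rewrite ler_pM ?powR_ge0 ?invr_ge0 ?powR_ge0// ?m_nd//.
  by rewrite lef_pV2 ?posrE ?natpowR_gt0 ?muln_gt0// ler_natpowR.
apply: (@dilation_growth_geometric (2 * b2 * C)^-1 s) => //.
  by rewrite invr_gt0 !mulr_gt0.
move=> j; exists (2 ^ j * 2)%N; first by rewrite leq_pmull// expn_gt0.
move=> p p1; pose Q := (2 ^ j * 2 * p)%N.
have Q0 : (0 < Q)%N by rewrite !muln_gt0 expn_gt0.
have sj : 0 < s ^+ j by rewrite exprn_gt0// (lt_trans _ s1).
(* [V Q] stops at index [Q - 1], so the hypothesis is applied there and monotonicity replaces
   [m (Q - 1)] by [m Q], and the denominator is already [Q^beta]. *)
have VQ : V Q <= C * (m Q / Q%:R `^ beta).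
  rewrite -{1 3}(prednK Q0) (le_trans (sumC _))// ler_wpM2l ?(ltW C0)//.
  by rewrite ler_wpM2r ?invr_ge0 ?powR_ge0// m_nd// leq_pred.
have := le_trans (ler_wpM2l (ltW sj) (below _ p1)) (iter j (2 * p)%N _).
rewrite muln_gt0 p1 mulnA -/Q => /(_ isT) /le_trans/(_ VQ).
have pb : 0 < p%:R `^ beta :> R by rewrite natpowR_gt0.
have kb : 0 < (2 ^ j * 2)%:R `^ beta :> R by rewrite natpowR_gt0// muln_gt0 expn_gt0.
rewrite [X in C * (_ / X)]natpowRM => h.
have w0 : 0 <= (2 ^ j * 2)%:R `^ beta * p%:R `^ beta / C by rewrite divr_ge0// ltW ?mulr_gt0.
have := ler_wpM2r w0 h; rewrite -/Q.
rewrite [X in X <= _ -> _](_ : _ = (2 * b2 * C)^-1 * s ^+ j * (2 ^ j * 2)%:R `^ beta * m p); last first.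
  by field; rewrite !gt_eqF.
rewrite [X in _ <= X -> _](_ : _ = m Q)//.
by field; rewrite !gt_eqF.
Qed.

(** * From power growth to the summation conditions *)

(** Adapts power growth to the weights [p+1] of the sums, including [p = 0]; the price is [2^a],
    from [q+2 <= 2(q+1)]. *)
Lemma power_growth_shift : power_growth -> exists a K : R,
  [/\ beta < a, 0 < K & forall p q, (p <= q)%N ->
    m p * q.+1%:R `^ a <= K * (m q * p.+1%:R `^ a)].
Proof.
move=> [a [K [ba K0 mK]]]; have a0 : 0 <= a by rewrite (le_trans beta_ge0) ?ltW.
exists a, (K * 2%:R `^ a); split=> // [|p q pq]; first by rewrite mulr_gt0 ?natpowR_gt0.
case: q pq => [|q pq].
  rewrite leqn0 => /eqP ->; rewrite ler_peMl ?mulr_ge0 ?powR_ge0// mulr_ege1 ?natpowR_ge1//.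
  (* The instance [p = q = 1] of power growth forces [1 <= K]. *)
  have := mK 1%N 1%N isT isT; rewrite -[leLHS]mul1r ler_pM2r//.
  by rewrite mulr_gt0// powR_gt0.
have q2 : q.+2%:R `^ a <= 2%:R `^ a * q.+1%:R `^ a :> R.
  by rewrite -natpowRM ler_natpowR//; lia.
(* [p.-1.+1] is the maximum of [p] and 1, so [p = 0] is handled through [m 0 <= m 1]. *)
apply: (@le_trans _ _ (m p.-1.+1 * (2%:R `^ a * q.+1%:R `^ a))).
  by rewrite ler_pM ?powR_ge0// m_nd//; lia.
rewrite mulrCA -mulrA [leRHS]mulrCA ler_wpM2l ?powR_ge0//.
apply: le_trans (mK p.-1.+1 q.+1 _ _) _ => //; first by lia.
by rewrite !ler_wpM2l ?(ltW K0)// ler_natpowR//; lia.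
Qed.

(** Power growth bounds [1 / m k] by a multiple of [(k+1)^(-a)], anchored at [p]; what remains is a
    sum of [(k+1)^(-1-e)] with [e = a - beta], which telescopes. *)
Lemma power_growth_tail_sum : power_growth -> exists2 C : R, 0 < C &
  forall p N, \sum_(p <= k < N) k.+1%:R `^ (beta - 1) / m k <=
     C * (p.+1%:R `^ beta / m p).
Proof.
move=> /power_growth_shift[a [K [ba K0 mK]]].
pose e := a - beta.
have e0 : 0 < e by rewrite subr_gt0.
have a0 : 0 <= a by rewrite (le_trans beta_ge0) ?ltW.
have kae k : k.+1%:R `^ (beta - 1) / k.+1%:R `^ a = (k.+1%:R * (k.+1%:R : R) `^ e)^-1.
  have k0 : k.+1%:R != 0 :> R by rewrite pnatr_eq0.
  rewrite -powRB ?k0 ?implybT// (_ : _ - a = - (1 + e)); last by rewrite /e; ring.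
  by rewrite powRN powRD ?k0 ?implybT// powRr1.
pose D := 2 * 2%:R `^ e / e.
have D0 : 0 < D by rewrite !mulr_gt0 ?invr_gt0 ?natpowR_gt0.
exists (K * D); first exact: mulr_gt0.
move=> p N; set P : R := p.+1%:R.
have P0 : 0 < P by rewrite ltr0n.
(* The sign makes [f] increasing, in the form needed for telescoping. *)
pose f k := - (k.+1%:R `^ e)^-1 : R.
have Kp : 0 <= K * P `^ a / m p * D by rewrite mulr_ge0 ?divr_ge0 ?mulr_ge0 ?powR_ge0 ?ltW.
have [pN|Np] := leqP p N; last first.
  by rewrite big_geq ?(ltnW Np)// mulr_ge0 ?divr_ge0 ?powR_ge0// ltW// mulr_gt0.
apply: (@le_trans _ _ (\sum_(p <= k < N) K * P `^ a / m p * D * (f k.+1 - f k))).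
  apply: ler_sum_nat => k /andP[pk _].
  have mkp : (m k)^-1 <= K * P `^ a / m p / k.+1%:R `^ a.
    rewrite ler_pdivlMr ?natpowR_gt0// ler_pdivlMr// -mulrA ler_pdivrMl//.
    by rewrite [leRHS]mulrCA [leLHS]mulrC mK.
  apply: le_trans (ler_wpM2l (powR_ge0 _ _) mkp) _.
  rewrite mulrCA kae -[leRHS]mulrA ler_wpM2l ?divr_ge0 ?mulr_ge0 ?powR_ge0 ?(ltW K0)//.
  by rewrite /f opprK addrC powR_telescope_decr.
rewrite -mulr_sumr telescope_sumr//.
apply: (@le_trans _ _ (K * P `^ a / m p * D * (P `^ e)^-1)).
  by rewrite ler_wpM2l// /f opprK gerDr oppr_le0 invr_ge0 powR_ge0.
have -> : P `^ a = P `^ beta * P `^ e.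
  rewrite -powRD ?(gt_eqF P0) ?implybT//; congr (_ `^ _).
  by rewrite /e; ring.
rewrite [leLHS](_ : _ = K * D * (P `^ beta / m p))//.
by field; rewrite !gt_eqF// powR_gt0.
Qed.

(** Here [m k] is bounded by a multiple of [(k+1)^a] anchored at [p], leaving a telescoping sum of
    [(k+1)^(e-1)]. Its end value [(p+2)^e] accounts for the factor [2^e]. *)
Lemma power_growth_head_sum : power_growth -> exists2 C : R, 0 < C &
  forall p, \sum_(0 <= k < p.+1) m k / k.+1%:R `^ (1 + beta) <=
     C * (m p / p.+1%:R `^ beta).
Proof.
move=> /power_growth_shift[a [K [ba K0 mK]]].
pose e := a - beta.
have e0 : 0 < e by rewrite subr_gt0.
have kae k : k.+1%:R `^ a / k.+1%:R `^ (1 + beta) = (k.+1%:R : R) `^ e / k.+1%:R.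
  have k0 : k.+1%:R != 0 :> R by rewrite pnatr_eq0.
  rewrite -powRB ?k0 ?implybT// (_ : a - _ = e - 1); last by rewrite /e; ring.
  by rewrite powRB ?k0 ?implybT// powRr1.
pose D := 2 / e.
have D0 : 0 < D by rewrite divr_gt0.
have d0 : 0 < 2%:R `^ e :> R by rewrite natpowR_gt0.
exists (K * D * 2%:R `^ e); first exact: mulr_gt0 (mulr_gt0 K0 D0) d0.
move=> p; set P : R := p.+1%:R.
have P0 : 0 < P by rewrite ltr0n.
have Pa : 0 < P `^ a by rewrite powR_gt0.
pose f k := (k.+1%:R : R) `^ e.
have Kp : 0 <= K * m p / P `^ a * D by rewrite mulr_ge0 ?divr_ge0 ?mulr_ge0 ?powR_ge0 ?ltW.
apply: (@le_trans _ _ (\sum_(0 <= k < p.+1) K * m p / P `^ a * D * (f k.+1 - f k))).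
  apply: ler_sum_nat => k /andP[_ kp].
  have mkp : m k <= K * m p / P `^ a * k.+1%:R `^ a.
    by rewrite mulrAC ler_pdivlMr// -mulrA mK.
  apply: le_trans (_ : K * m p / P `^ a * k.+1%:R `^ a / k.+1%:R `^ (1 + beta) <= _).
    by rewrite ler_wpM2r ?invr_ge0 ?powR_ge0.
  rewrite -mulrA kae -[leRHS]mulrA ler_wpM2l ?divr_ge0 ?mulr_ge0 ?powR_ge0 ?(ltW K0)//.
  by rewrite /f powR_telescope_incr.
rewrite -mulr_sumr telescope_sumr//.
apply: (@le_trans _ _ (K * m p / P `^ a * D * (2%:R `^ e * P `^ e))).
  rewrite ler_wpM2l// /f lerBlDr (@le_trans _ _ (2%:R `^ e * P `^ e))//.
    by rewrite -natpowRM ler_natpowR ?(ltW e0)//; lia.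
  by rewrite lerDl powR_ge0.
have -> : P `^ a = P `^ beta * P `^ e.
  rewrite -powRD ?(gt_eqF P0) ?implybT//; congr (_ `^ _).
  by rewrite /e; ring.
rewrite [leLHS](_ : _ = K * D * 2%:R `^ e * (m p / P `^ beta))//.
by field; rewrite !gt_eqF// powR_gt0.
Qed.

(** * Regular sequences equivalent to [m] *)

(* [h p = p ^ a * inf_(q >= p) m q / q ^ a] for [p >= 1]; the value [h 0] is the largest
   one keeping [(p + 1) ^ - a * h p] nondecreasing. *)
Lemma power_growth_regularize : power_growth -> exists (a : R) (h : nat -> R),
  [/\ beta < a, equiv_seq h m,
      nondecreasing_seq (fun p => p.+1%:R `^ (- a) * h p) &
      forall p, (1 <= p)%N -> 2 `^ a * h p <= h (2 * p)%N].
Proof.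
move=> [a [K [ba K0 mK]]]; have a0 : 0 <= a by rewrite (le_trans beta_ge0) ?ltW.
pose S p : set R := [set m q / q%:R `^ a | q in [set q | (p <= q)%N]].
pose g p := inf (S p).
have S0 p : S p !=set0 by exists (m p / p%:R `^ a), p => //=.
have lbS p : has_lbound (S p).
  by exists 0 => _ [q _ <-]; rewrite divr_ge0 ?powR_ge0.
have gle p : g p <= m p / p%:R `^ a by apply: ge_inf => //; exists p => /=.
have gge p : (1 <= p)%N -> K^-1 * (m p / p%:R `^ a) <= g p.
  move=> p1; apply: lb_le_inf => // _ [q /= pq <-].
  rewrite ler_pdivrMl// mulrA ler_pdivlMr ?natpowR_gt0 ?(leq_trans p1)//.
  by rewrite mulrAC ler_pdivrMr ?natpowR_gt0// -mulrA mK.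
have gnd p q : (p <= q)%N -> g p <= g q.
  move=> pq; apply: lb_le_inf => // _ [r /= qr <-].
  by apply: ge_inf => //; exists r => //=; exact: leq_trans qr.
have g0 p : 0 <= g p.
  by apply: lb_le_inf => // _ [q _ <-]; rewrite divr_ge0 ?powR_ge0.
pose h p := if p is 0%N then 2%:R `^ (- a) * g 1%N else p%:R `^ a * g p.
have hS p : (1 <= p)%N -> h p = p%:R `^ a * g p by case: p.
have t0 : 0 < 2%:R `^ a :> R by rewrite natpowR_gt0.
have t1 : 1 <= 2%:R `^ a :> R by rewrite natpowR_ge1.
exists a, h; split=> //.
(* One constant for all bounds: [K 2^a] serves the lower ones, [m 1 / m 0] the upper one at [p = 0],
   and 1 the upper ones at [p >= 1]. *)
- pose c := 1 + K * 2%:R `^ a + m 1%N / m 0%N.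
  have [c1 cK cm] : [/\ 1 <= c, K * 2%:R `^ a <= c & m 1%N / m 0%N <= c].
    have := mulr_gt0 K0 t0; have := divr_gt0 (m_gt0 1) (m_gt0 0).
    by rewrite /c; split; lra.
  have c0 : 0 < c by rewrite (lt_le_trans _ c1).
  have cV : c^-1 <= K^-1 * (2%:R `^ a)^-1.
    by rewrite -invfM lef_pV2 ?posrE// mulr_gt0.
  have m1g : K^-1 * m 1%N <= g 1%N by have := gge 1%N isT; rewrite powR1 divr1.
  have g1m : g 1%N <= m 1%N by have := gle 1%N; rewrite powR1 divr1.
  exists c; split=> // -[|p].
    rewrite /h powRN; split; last first.
      apply: (@le_trans _ _ (m 1%N)); last by rewrite -ler_pdivrMr.
      by rewrite (le_trans _ g1m)// ler_piMl// invf_le1.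
    apply: (@le_trans _ _ (K^-1 * (2%:R `^ a)^-1 * m 1%N)).
      by rewrite ler_pM ?invr_ge0 ?(ltW c0)// m_nd.
    by rewrite mulrAC mulrC ler_wpM2l// invr_ge0 ltW.
  have pa : 0 < p.+1%:R `^ a :> R by rewrite natpowR_gt0.
  rewrite hS//; split.
    apply: (@le_trans _ _ (K^-1 * m p.+1)).
      rewrite ler_wpM2r// (le_trans cV)// ler_piMr ?invr_ge0 ?(ltW K0)//.
      by rewrite invf_le1.
    by rewrite [leRHS]mulrC -ler_pdivrMr// -mulrA gge.
  rewrite mulrC -ler_pdivlMr// (le_trans (gle _))// ler_wpM2r ?invr_ge0 ?(ltW pa)//.
  by rewrite ler_peMl.
- apply/nondecreasing_seqP => -[|p].
    by rewrite /h !powR1 !mul1r.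
  rewrite !hS// !powRN.
  have q1 : 0 < p.+2%:R `^ a :> R by rewrite natpowR_gt0.
  have q2 : 0 < p.+3%:R `^ a :> R by rewrite natpowR_gt0.
  (* Beyond the monotonicity of [g] this amounts to [(p+1)(p+3) <= (p+2)^2]. *)
  rewrite ler_pdivrMl// !mulrA ler_pM ?powR_ge0 ?gnd//.
  rewrite mulrAC ler_pdivlMr// -!natpowRM ler_natpowR//; lia.
- move=> p p1; rewrite !hS ?muln_gt0// natpowRM mulrA ler_wpM2l ?mulr_ge0 ?powR_ge0//.
  by rewrite gnd// leq_pmull.
Qed.

(** Iterating on [h] rather than on [m] costs the equivalence constant only twice, however many
    doublings are made, so the gain [(y / 2^beta)^j] wins. *)
Lemma regular_sequence_dilation (h : nat -> R) : equiv_seq h m ->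
  ((2 `^ beta)%:E <
     ereal_inf [set (h (2 * p)%N / h p)%:E | p in [set p : nat | (1 <= p)%N]])%E ->
  dilation_growth.
Proof.
move=> [c [c1 hm]] /lte_fin_witness[y by_ yinf].
have c0 : 0 < c by rewrite (lt_le_trans _ c1).
have h0 p : 0 < h p by have [+ _] := hm p; apply: lt_le_trans; rewrite mulr_gt0 ?invr_gt0.
have b0 : 0 < 2%:R `^ beta :> R by rewrite natpowR_gt0.
have y0 : 0 < y by rewrite (lt_trans _ by_).
have hy p : (1 <= p)%N -> y * h p <= h (2 * p)%N.
  move=> p1; rewrite -ler_pdivlMr// -lee_fin (le_trans yinf)//.
  by apply: ereal_inf_lbound; exists p.
have iter j p : (1 <= p)%N -> y ^+ j * h p <= h (2 ^ j * p)%N.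
  move=> p1; elim: j => [|j ih]; first by rewrite expr0 mul1r mul1n.
  rewrite exprS -mulrA (le_trans (ler_wpM2l (ltW y0) ih))//.
  by rewrite expnS -mulnA hy// muln_gt0 expn_gt0.
apply: (@dilation_growth_geometric (c ^- 2) (y / 2%:R `^ beta)).
- by rewrite invr_gt0 exprn_gt0.
- by rewrite ltr_pdivlMr// mul1r.
(* The exponent [j.+1] keeps [2 <= k] at [j = 0]; the additional doubling is paid for by
   [2^beta <= y]. *)
move=> j; exists (2 ^ j.+1)%N; first by rewrite expnS leq_pmulr// expn_gt0.
move=> p p1; rewrite natpowRX.
apply: (@le_trans _ _ (c^-1 * h (2 ^ j.+1 * p)%N)); last first.
  by rewrite ler_pdivrMl//; have [] := hm (2 ^ j.+1 * p)%N.
apply: (@le_trans _ _ (c^-1 * (y ^+ j.+1 * (c^-1 * m p)))); last first.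
  rewrite ler_wpM2l ?invr_ge0 ?(ltW c0)// (le_trans _ (iter _ _ p1))//.
  by rewrite ler_wpM2l ?exprn_ge0 ?(ltW y0)//; have [] := hm p.
rewrite [leLHS](_ : _ = c^-1 * (y ^+ j * 2%:R `^ beta * (c^-1 * m p))); last first.
  rewrite exprMn exprVn [(2%:R `^ beta) ^+ j.+1]exprS; field.
  by rewrite expf_neq0 ?gt_eqF.
rewrite ler_wpM2l ?invr_ge0 ?(ltW c0)// ler_wpM2r ?mulr_ge0 ?invr_ge0 ?(ltW c0)//.
by rewrite exprSr ler_wpM2l ?exprn_ge0 ?(ltW y0)// ltW.
Qed.

(** * The lower Matuszewska index *)

Lemma matuszewska_dilation : (beta%:E < beta_index m)%E -> dilation_growth.
Proof.
move=> /ereal_sup_gt[_ [b [D [D0 fD]] <-]]; rewrite lte_fin => bb.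
have e0 : 0 < b - beta by rewrite subr_gt0.
(* The target makes [(D/2) k^(b-beta)] exceed [2^beta], as needed for the dilation factor [2k]. *)
have [N zN] := @powR_unbounded R (b - beta) (2%:R `^ beta * (2 / D) + 1) e0.
pose k := (maxn N 2)%N.
have k1 : 1 < k%:R :> R by rewrite ltr1n leq_max orbT.
have k0 : (0 < k)%N by rewrite leq_max orbT.
pose inner x := ereal_inf [set (step_fun m (l * x) / (l `^ b * step_fun m x))%:E
  | l in [set l : R | (1 <= l <= k%:R)%R]].
have D2 : ((D / 2)%:E < liminf_infty inner)%E.
  by rewrite (lt_le_trans _ (fD _ k1))// lte_fin; lra.
have [_ [x _ <-] xD] := ereal_sup_gt D2.
(* The step function at [k(p+1)] is [m (k(p+1) - 1)]; doubling [k] absorbs the shift, since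
   [k(p+1) - 1 <= 2kp] for [p >= 1]. *)
exists (2 * k)%N, (D / 2 * k%:R `^ b), (Num.bound `|x|).+1; split.
- by rewrite leq_pmulr.
- rewrite natpowRM.
  have -> : k%:R `^ b = k%:R `^ beta * k%:R `^ (b - beta) :> R.
    by rewrite -powRD ?pnatr_eq0 -?lt0n ?k0 ?implybT// addrC subrK.
  have kb : 0 < k%:R `^ beta :> R by rewrite natpowR_gt0.
  rewrite [ltRHS](_ : _ = (D / 2 * k%:R `^ (b - beta)) * k%:R `^ beta); last by ring.
  rewrite ltr_pM2r// -ltr_pdivrMl ?divr_gt0// invf_div mulrC.
  by rewrite (lt_le_trans _ (zN k _)) ?ltrDl// leq_max leqnn.
- move=> p xp.
  have xp1 : x <= p.+1%:R.
    rewrite (le_trans (ler_norm _))// (le_trans (ltW (archi_boundP _)))// ler_nat.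
    by apply: leqW; exact: ltnW.
  have : ((D / 2)%:E <= (step_fun m (k%:R * p.+1%:R) /
      (k%:R `^ b * step_fun m p.+1%:R))%:E)%E.
    apply: le_trans (ltW xD) _; apply: (@le_trans _ _ (inner p.+1%:R)).
      by apply: ereal_inf_lbound; exists p.+1%:R.
    by apply: ereal_inf_lbound; exists k%:R => //=; rewrite lexx ltW.
  rewrite lee_fin /step_fun -natrM !natrK/=.
  rewrite ler_pdivlMr ?mulr_gt0 ?natpowR_gt0// mulrA => /le_trans; apply.
  by apply: m_nd; rewrite -mulnA mulnCA mulnS; nia.
Qed.

Lemma power_growth_matuszewska : power_growth -> (beta%:E < beta_index m)%E.
Proof.
move=> [a [K [ba K0 mK]]]; have a0 : 0 <= a by rewrite (le_trans beta_ge0) ?ltW.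
apply: lt_le_trans (_ : (a%:E <= _)%E); first by rewrite lte_fin.
apply: ereal_sup_ubound; exists a => //=.
have t0 : 0 < 3%:R `^ a :> R by rewrite natpowR_gt0.
(* The 3 comes from truncation: if [p] and [q'] are the integer parts of [y] and [l y] minus one,
   then [l p <= l y < q' + 2 <= 3 q']. Restricting to [y >= 2] gives [q' >= p >= 1]. *)
exists (K * 3%:R `^ a)^-1; split; first by rewrite invr_gt0 mulr_gt0.
move=> L L1.
pose inner x := ereal_inf [set (step_fun m (l * x) / (l `^ a * step_fun m x))%:E
  | l in [set l : R | (1 <= l <= L)%R]].
apply: (@le_trans _ _ (ereal_inf [set inner y | y in [set y : R | 2 <= y]])); last first.
  by apply: ereal_sup_ubound; exists 2.
apply: le_ereal_inf_tmp => _ [y /= y2 <-].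
apply: le_ereal_inf_tmp => _ [l /= /andP[l1 _] <-].
have y0 : 0 <= y by lra.
have l0 : 0 < l by lra.
have ly0 : 0 <= l * y by rewrite mulr_ge0// ltW.
have yt : (2 <= Num.truncn y)%N by rewrite truncn_ge_nat//; exact: y2.
have lyt : (Num.truncn y <= Num.truncn (l * y))%N by rewrite le_truncn// ler_peMl.
have /andP[uy _] := truncn_itv y0; have /andP[_ lyv] := truncn_itv ly0.
rewrite lee_fin /step_fun.
move: (Num.truncn y) (Num.truncn (l * y)) yt lyt uy lyv => [|[|p']]// [|q']//= _ p'q uy lyv.
set p := p'.+1 in p'q *; have {p'q} pq : (p <= q')%N by [].
have pa : 0 < p%:R `^ a :> R by rewrite natpowR_gt0.
have la : 0 < l `^ a by rewrite powR_gt0.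
have lpq : l * p%:R <= (3 * q')%:R.
  apply: (@le_trans _ _ (l * y)).
    by rewrite ler_wpM2l ?(ltW l0)// (le_trans _ uy)// ler_nat.
  rewrite (le_trans (ltW lyv))// ler_nat.
  by move: pq; rewrite /p; clear; lia.
have lpqa : l `^ a * p%:R `^ a <= 3%:R `^ a * q'%:R `^ a.
  by rewrite -natpowRM -powRM ?(ltW l0)// ge0_ler_powR ?nnegrE ?mulr_ge0 ?(ltW l0).
rewrite ler_pdivlMr ?mulr_gt0// ler_pdivrMl ?mulr_gt0//.
rewrite -(ler_pM2r pa).
apply: (@le_trans _ _ (3%:R `^ a * (m p * q'%:R `^ a))).
  by rewrite mulrAC [leRHS]mulrCA [leRHS]mulrC ler_wpM2r.
rewrite [leRHS](_ : _ = 3%:R `^ a * (K * (m q' * p%:R `^ a))); last by ring.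
by rewrite ler_wpM2l ?(ltW t0)// mK.
Qed.

(** * Almost increasing quotients, regular sequences and the index [gamma_index] *)

Lemma almost_increasing_power_growth (e : R) : 0 < e ->
  almost_increasing (fun p => m p / p%:R `^ (beta + e)) -> power_growth.
Proof.
move=> e0 [K [K0 mK]]; exists (beta + e), K; split=> //; first by rewrite ltrDl.
move=> p q p1 pq; have := mK p q p1 pq.
rewrite ler_pdivrMr ?natpowR_gt0// mulrA mulrAC ler_pdivlMr ?natpowR_gt0 ?(leq_trans p1)//.
by rewrite mulrA.
Qed.

Lemma power_growth_almost_increasing : power_growth -> exists e : R, 0 < e /\
  almost_increasing (fun p => m p / p%:R `^ (beta + e)).
Proof.
move=> [a [K [ba K0 mK]]]; exists (a - beta); split; first by rewrite subr_gt0.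
rewrite addrC subrK; exists K; split=> // p q p1 pq.
rewrite ler_pdivrMr ?natpowR_gt0// mulrA mulrAC ler_pdivlMr ?natpowR_gt0 ?(leq_trans p1)//.
by rewrite -mulrA mK.
Qed.

(** Regularizing at an exponent [a > beta] leaves room for both demands: the factor [(p+1)^(a-beta)]
    preserves monotonicity, and doubling gains [2^a > 2^beta]. *)
Lemma power_growth_regular_sequence : power_growth -> exists h : nat -> R, equiv_seq h m /\
  nondecreasing_seq (fun p : nat => p.+1%:R `^ (- beta) * h p) /\
  ((2 `^ beta)%:E <
     ereal_inf [set (h (2 * p)%N / h p)%:E | p in [set p : nat | (1 <= p)%N]])%E.
Proof.
move=> /power_growth_regularize[a [h [ba hm hnd h2]]].
have h0 p : 0 < h p.
  have [c [c1 /(_ p)[+ _]]] := hm; apply: lt_le_trans.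
  by rewrite mulr_gt0 ?invr_gt0 ?(lt_le_trans _ c1).
exists h; split=> //; split.
  move=> p q pq.
  have split_pow k : k.+1%:R `^ (- beta) * h k =
      k.+1%:R `^ (a - beta) * (k.+1%:R `^ (- a) * h k).
    rewrite mulrA -powRD; last by rewrite pnatr_eq0 implybT.
    by congr (_ `^ _ * _); ring.
  rewrite !split_pow ler_pM ?mulr_ge0 ?powR_ge0 ?(ltW (h0 _))//; last exact: hnd.
  by rewrite ler_natpowR// subr_ge0 ltW.
apply: (@lt_le_trans _ _ (2 `^ a)%:E).
  rewrite lte_fin /powR pnatr_eq0/= ltr_expR ltr_pM2r// ln_gt0// ltr1n//.
by apply: le_ereal_inf_tmp => _ [p /= p1 <-]; rewrite lee_fin ler_pdivlMr// h2.
Qed.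

Lemma power_growth_gamma (M : nat -> R) : quot M = m -> power_growth ->
  (beta%:E < gamma_index M)%E.
Proof.
move=> Mm /power_growth_regularize[a [h [ba hm hnd _]]].
apply: (@lt_le_trans _ _ a%:E); first by rewrite lte_fin.
by apply: ereal_sup_ubound; exists a => //; exists h; rewrite Mm.
Qed.

(** Some admissible exponent [a] exceeds [beta]; passing between [m] and [h] costs [c] twice, and
    [p+1 <= 2p] costs [2^a]. *)
Lemma gamma_power_growth (M : nat -> R) : quot M = m ->
  (beta%:E < gamma_index M)%E -> power_growth.
Proof.
move=> Mm /ereal_sup_gt[_ [a [h [+ hnd]] <-]]; rewrite Mm lte_fin => -[c [c1 hm]] ba.
have c0 : 0 < c by rewrite (lt_le_trans _ c1).
have a0 : 0 <= a by rewrite (le_trans beta_ge0) ?ltW.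
exists a, (c * (c * 2%:R `^ a)); split=> //; first by rewrite !mulr_gt0 ?natpowR_gt0.
move=> p q p1 pq.
have hpq : h p * q.+1%:R `^ a <= h q * p.+1%:R `^ a.
  have := hnd _ _ pq; rewrite !powRN ler_pdivrMl ?natpowR_gt0//.
  rewrite mulrCA mulrC mulrC ler_pdivlMl ?natpowR_gt0//.
  by rewrite mulrC [leRHS]mulrC.
have mh : m p <= c * h p by rewrite -ler_pdivrMl//; have [] := hm p.
apply: (@le_trans _ _ (c * h p * q.+1%:R `^ a)).
  by rewrite ler_pM ?powR_ge0// ler_natpowR.
rewrite -!mulrA ler_pM2l// (le_trans hpq)//.
rewrite [leRHS](_ : _ = c * m q * (2%:R `^ a * p%:R `^ a)); last by ring.
rewrite -natpowRM ler_pM ?powR_ge0//; last by rewrite ler_natpowR//; lia.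
- by have [+ _] := hm q; apply: le_trans; rewrite mulr_ge0 ?invr_ge0 ?(ltW c0).
- by have [] := hm q.
Qed.

(** * Lower limits and uniform dilation bounds *)

(** The threshold on [k] is uniform in [p], so the lower limits and the pointwise bound over all
    [p >= 1] follow alike. *)
Lemma power_growth_dilate_large (y : R) : 0 < y -> power_growth ->
  exists N, forall k p, (N <= k)%N -> (1 <= k)%N -> (1 <= p)%N ->
    y * (k%:R `^ beta * m p) <= m (k * p)%N.
Proof.
move=> y0 /power_growth_dilate[c [e [c0 e0 mk]]].
have [N Nk] := @powR_unbounded R e (y / c) e0.
exists N => k p /Nk; rewrite ler_pdivrMr// mulrC => yk k1 p1.
apply: le_trans (mk _ _ k1 p1); rewrite ler_wpM2r// mulr_ge0 ?powR_ge0//.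
Qed.

Lemma power_growth_liminf_dilate : power_growth ->
  (fun k : nat => limn_einf (fun p : nat => (m (k * p)%N / ((k%:R) `^ beta * m p))%:E))
      @ \oo --> +oo%E.
Proof.
move=> pg; apply/cvgeyPge => A.
have [|N Nk] := power_growth_dilate_large (Num.max A 1) _ pg.
  by rewrite lt_max ltr01 orbT.
near=> k; have k1 : (1 <= k)%N by near: k; exists 1%N.
apply: (@limn_einf_ge _ _ _ 1) => p p1.
rewrite ler_pdivlMr ?mulr_gt0 ?natpowR_gt0//.
apply: le_trans (Nk k p _ k1 p1); last by near: k; exists N.
by rewrite ler_wpM2r ?mulr_ge0 ?powR_ge0// le_max lexx.
Unshelve. all: by end_near. Qed.

Lemma liminf_dilate_dilation :
  (fun k : nat => limn_einf (fun p : nat => (m (k * p)%N / ((k%:R) `^ beta * m p))%:E))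
      @ \oo --> +oo%E -> dilation_growth.
Proof.
move=> /cvgey_ge/(_ 2)[N _ Nk].
pose k := maxn N 2.
have k0 : (0 < k)%N by rewrite leq_max orbT.
have kb : 0 < k%:R `^ beta :> R by rewrite natpowR_gt0.
have := Nk k; rewrite /= leq_maxl => /(_ isT) k2.
have /limn_einf_gt[y [N1 [y1 yN]]] : (1%:E < limn_einf (fun p : nat =>
    (m (k * p)%N / ((k%:R) `^ beta * m p))%:E))%E.
  by rewrite (lt_le_trans _ k2)// lte_fin ltr1n.
exists k, (y * k%:R `^ beta), N1; split.
- by rewrite leq_max orbT.
- by rewrite ltr_pMl.
- by move=> p /yN; rewrite ler_pdivlMr ?mulr_gt0// mulrA.
Qed.

Lemma power_growth_liminf : power_growth -> exists k : nat, (2 <= k)%N /\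
  ((k%:R `^ beta)%:E < limn_einf (fun p : nat => (m (k * p)%N / m p)%:E))%E.
Proof.
move=> pg; have [//|N Nk] := power_growth_dilate_large 2 _ pg.
pose k := maxn N 2; exists k; split; first by rewrite leq_max orbT.
have k0 : (0 < k)%N by rewrite leq_max orbT.
apply: (@lt_le_trans _ _ (2 * k%:R `^ beta)%:E).
  by rewrite lte_fin ltr_pMl ?natpowR_gt0// ltr1n.
apply: (@limn_einf_ge _ _ _ 1) => p p1; rewrite ler_pdivlMr// -mulrA.
by apply: Nk => //; rewrite leq_maxl.
Qed.

Lemma liminf_dilation k : (2 <= k)%N ->
  ((k%:R `^ beta)%:E < limn_einf (fun p : nat => (m (k * p)%N / m p)%:E))%E ->
  dilation_growth.
Proof.
move=> k2 /limn_einf_gt[y [N [ky yN]]]; exists k, y, N; split=> // p /yN.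
by rewrite ler_pdivlMr.
Qed.

Lemma power_growth_scaled_bound (theta : R) : 0 < theta -> power_growth ->
  exists k : nat, (2 <= k)%N /\
    forall p : nat, (1 <= p)%N -> m p <= theta * (k%:R `^ (- beta)) * m (k * p)%N.
Proof.
move=> t0 pg; have [|N Nk] := power_growth_dilate_large theta^-1 _ pg.
  by rewrite invr_gt0.
pose k := maxn N 2; exists k; split; first by rewrite leq_max orbT.
have k0 : (0 < k)%N by rewrite leq_max orbT.
move=> p p1; rewrite powRN -mulrA -ler_pdivrMl// ler_pdivlMl ?natpowR_gt0//.
by rewrite mulrCA Nk// leq_maxl.
Qed.

Lemma scaled_bound_dilation (theta : R) k : 0 < theta < 1 -> (2 <= k)%N ->
  (forall p, (1 <= p)%N -> m p <= theta * (k%:R `^ (- beta)) * m (k * p)%N) ->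
  dilation_growth.
Proof.
move=> /andP[t0 t1] k2 mk.
have kb : 0 < k%:R `^ beta :> R by rewrite natpowR_gt0// (leq_trans _ k2).
exists k, (theta^-1 * k%:R `^ beta), 1%N; split=> //.
  by rewrite ltr_pMl// invf_gt1.
move=> p /mk; rewrite powRN -mulrA -ler_pdivrMl// ler_pdivlMl// => h.
by rewrite mulrAC mulrC.
Qed.

(** * Infinite series as limits of the finite tail sums *)

Lemma power_growth_series : power_growth -> exists C : R, 0 < C /\ forall p : nat,
  (\sum_(p <= k <oo) (k.+1%:R `^ (beta - 1) / m k)%:E
    <= (C * (p.+1%:R `^ beta / m p))%:E)%E.
Proof.
move=> /power_growth_tail_sum[C C0 sumC]; exists C; split=> // p.
apply: lime_le.
  by apply: is_cvg_nneseries => k _ _; rewrite lee_fin divr_ge0 ?powR_ge0.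
by apply: nearW => N; rewrite sumEFin lee_fin.
Qed.

Lemma series_dilation (C : R) : 0 < C -> (forall p : nat,
  (\sum_(p <= k <oo) (k.+1%:R `^ (beta - 1) / m k)%:E
    <= (C * (p.+1%:R `^ beta / m p))%:E)%E) -> dilation_growth.
Proof.
move=> C0 sumC; apply: (tail_sum_dilation C C0) => p N.
rewrite -lee_fin -sumEFin; apply: le_trans (sumC p).
by apply: nneseries_lim_ge => k _ _; rewrite lee_fin divr_ge0 ?powR_ge0.
Qed.

End Growth.

(** * Quotients of a weight sequence, and the cycle of implications *)

Lemma weight_sequence_quot_gt0 (R : realType) (M : nat -> R) p :
  weight_sequence M -> 0 < quot M p.
Proof. by case=> _ M0 _ _; rewrite divr_gt0. Qed.

Lemma weight_sequence_quot_nondecreasing (R : realType) (M : nat -> R) :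
  weight_sequence M -> nondecreasing_seq (quot M).
Proof.
case=> _ M0 Mlc _; apply/nondecreasing_seqP => p.
rewrite /quot ler_pdivrMr// mulrAC ler_pdivlMr// -expr2 [leRHS]mulrC.
exact: (Mlc p.+1).
Qed.

Theorem theorem3p11 (R : realType) (M : nat -> R) (beta : R) :
  weight_sequence M -> 0 <= beta ->
  let m := quot M in
  [<->
   (* (i) *)
   (exists C : R, 0 < C /\ forall p : nat,
      (\sum_(p <= k <oo) ((k.+1%:R) `^ (beta - 1) / m k)%:E
        <= (C * ((p.+1%:R) `^ beta / m p))%:E)%E);
   (* (ii) *)
   (exists eps : R, 0 < eps /\
      almost_increasing (fun p : nat => m p / (p%:R) `^ (beta + eps)));
   (* (iii) *)
   (exists h : nat -> R, equiv_seq h m /\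
      nondecreasing_seq (fun p : nat => (p.+1%:R) `^ (- beta) * h p) /\
      ((2 `^ beta)%:E <
         ereal_inf [set (h (2 * p)%N / h p)%:E | p in [set p : nat | (1 <= p)%N]])%E);
   (* (iv) *)
   ((fun k : nat => limn_einf (fun p : nat => (m (k * p)%N / ((k%:R) `^ beta * m p))%:E))
      @ \oo --> +oo%E);
   (* (v) *)
   (exists k : nat, (2 <= k)%N /\
      ((k%:R `^ beta)%:E < limn_einf (fun p : nat => (m (k * p)%N / m p)%:E))%E);
   (* (vi) *)
   (forall theta : R, 0 < theta < 1 -> exists k : nat, (2 <= k)%N /\
      forall p : nat, (1 <= p)%N -> m p <= theta * (k%:R `^ (- beta)) * m (k * p)%N);
   (* (vii) *)
   (beta%:E < beta_index m)%E;
   (* (viii) *)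
   (beta%:E < gamma_index M)%E;
   (* (ix) *)
   (exists C : R, 0 < C /\ forall p : nat,
      \sum_(0 <= k < p.+1) m k / (k.+1%:R) `^ (1 + beta)
        <= C * (m p / (p.+1%:R) `^ beta))].
Proof.
move=> wM beta0 m.
have m_gt0 p : 0 < m p by apply: weight_sequence_quot_gt0.
have m_nd : nondecreasing_seq m by apply: weight_sequence_quot_nondecreasing.
have dp : dilation_growth R m beta -> power_growth R m beta.
  by apply: dilation_growth_power.
(* In the cycle of implications every arrow factors through power growth, reached directly or by way
   of dilation growth. *)
tfae.
- move=> [C [C0 sumC]]; apply: power_growth_almost_increasing => //; apply: dp.
  exact: series_dilation sumC.
- move=> [e [e0 me]]; apply: power_growth_regular_sequence => //.
  exact: almost_increasing_power_growth me.
- move=> [h [hm [_ h2]]]; apply: power_growth_liminf_dilate => //; apply: dp.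
  exact: regular_sequence_dilation h2.
- move=> mk; apply: power_growth_liminf => //; apply: dp.
  exact: liminf_dilate_dilation.
- move=> [k [k2 mk]] theta /andP[t0 _]; apply: power_growth_scaled_bound => //; apply: dp.
  exact: liminf_dilation mk.
- move=> mt; apply: power_growth_matuszewska => //; apply: dp.
  have half : 0 < (2^-1 : R) < 1 by rewrite invr_gt0 ltr0n invf_lt1// ltr1n.
  have [k [k2 mk]] := mt _ half.
  exact: scaled_bound_dilation mk.
- move=> bm; apply: power_growth_gamma => //; apply: dp.
  exact: matuszewska_dilation.
- move=> gM; have pg : power_growth R m beta by apply: gamma_power_growth gM.
  by have [C C0 sumC] := power_growth_head_sum R m beta m_gt0 m_nd beta0 pg; exists C.
- move=> [C [C0 sumC]]; apply: power_growth_series => //; apply: dp.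
  exact: head_sum_dilation sumC.
Qed.
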